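(* Every mock-Lie superalgebra $(\mathcal{J},\bullet)$ is a Jordan superalgebra (with the same product $\bullet$), and it satisfies $x^3=0$ for every homogeneous $x\in\mathcal{J}$, where $x^2=x\bullet x$ and $x^3=x\bullet x^2$.
   Context: All vector spaces are finite-dimensional over a field $\mathbb{K}$ of characteristic $0$. For a $\mathbb{Z}_2$-graded vector space $\mathcal{V}=\mathcal{V}_{\bar 0}\oplus\mathcal{V}_{\bar 1}$, $|x|$ denotes the degree of a homogeneous element $x$; formulas involving degrees are for homogeneous elements. A mock-Lie superalgebra is a $\mathbb{Z}_2$-graded vector space $\mathcal{J}$ with an even bilinear product $\bullet$ (i.e. $\mathcal{J}_i\bullet\mathcal{J}_j\subset\mathcal{J}_{i+j}$) such that for all homogeneous $x,y,z$: $x\bullet y=(-1)^{|x||y|}y\bullet x$ (super-commutativity), and $(-1)^{|x||z|}x\bullet(y\bullet z)+(-1)^{|x||y|}y\bullet(z\bullet x)+(-1)^{|y||z|}z\bullet(x\bullet y)=0$ (super-Jacobi identity). A Jordan superalgebra is a $\mathbb{Z}_2$-graded vector space with an even super-commutative bilinear product $\bullet$ such that for all homogeneous $a,b,c$ and all $d$: $$(-1)^{|a||c|}(a\bullet b)\bullet(c\bullet d)+(-1)^{|a||b|}(b\bullet c)\bullet(a\bullet d)+(-1)^{|c||b|}(c\bullet a)\bullet(b\bullet d)$$ $$=(-1)^{|a||c|}a\bullet((b\bullet c)\bullet d)+(-1)^{|a||b|}b\bullet((c\bullet a)\bullet d)+(-1)^{|c||b|}c\bullet((a\bullet b)\bullet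 d).$$ *)

(* Defs.v *)
From HB Require Import structures.
From mathcomp Require Import all_boot all_order all_algebra.

Set Implicit Arguments.
Unset Strict Implicit.
Unset Printing Implicit Defensive.

Import GRing.Theory.
Local Open Scope ring_scope.

(* Degrees in Z/2 are booleans: true is the odd degree, (+) is the addition of
   Z/2, and i && j is the product of the degrees i and j.  The zero vector is
   homogeneous of both degrees. *)
Definition Z2_grading (K : fieldType) (V : vectType K)
    (V_ : bool -> {vspace V}) : Prop :=
  directv (V_ false + V_ true)%VS /\ (V_ false + V_ true)%VS = fullv.

Section SuperAlgebras.

Variables (K : fieldType) (V : vectType K).
Variables (V_ : bool -> {vspace V}) (mul : {bilinear V -> V -> V}).

Local Notation "x ** y" := (mul x y) (at level 40, left associativity).
Local Notation sgn i j := ((-1 : K) ^+ (i && j)).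

Definition even_product : Prop :=
  forall i j x y, x \in V_ i -> y \in V_ j -> x ** y \in V_ (i (+) j).

Definition super_commutative : Prop :=
  forall i j x y, x \in V_ i -> y \in V_ j -> x ** y = sgn i j *: (y ** x).

Definition super_Jacobi : Prop :=
  forall i j k x y z, x \in V_ i -> y \in V_ j -> z \in V_ k ->
    sgn i k *: (x ** (y ** z)) + sgn i j *: (y ** (z ** x))
      + sgn j k *: (z ** (x ** y)) = 0.

Definition super_Jordan : Prop :=
  forall i j k a b c d, a \in V_ i -> b \in V_ j -> c \in V_ k ->
    sgn i k *: ((a ** b) ** (c ** d)) + sgn i j *: ((b ** c) ** (a ** d))
      + sgn k j *: ((c ** a) ** (b ** d))
    = sgn i k *: (a ** ((b ** c) ** d)) + sgn i j *: (b ** ((c ** a) ** d))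
      + sgn k j *: (c ** ((a ** b) ** d)).

Definition mock_Lie_superalgebra : Prop :=
  [/\ Z2_grading V_, even_product, super_commutative & super_Jacobi].

Definition Jordan_superalgebra : Prop :=
  [/\ Z2_grading V_, even_product, super_commutative & super_Jordan].

End SuperAlgebras.

(* Main.v *)
(** The super-Jacobi identity says that left multiplications satisfy
    [L_(xy) = - L_x L_y - (-1)^(|x||y|) L_y L_x].  Applying this to the product
    [ab] in [(ab)(cd)] on the left of the Jordan identity, and to [bc] in
    [a((bc)d)] on the right, turns both sides into minus the same signed sum of
    the six words [L_a L_b L_c d] over the permutations of [a, b, c]. *)
Require Import Defs.
From mathcomp Require Import all_boot all_order all_algebra.

Set Implicit Arguments.
Unset Strict Implicit.
Unset Printing Implicit Defensive.

Import GRing.Theory.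
Local Open Scope ring_scope.

Lemma Z2_gradingP (K : fieldType) (V : vectType K)
    (V_ : bool -> {vspace V}) (v : V) :
  Z2_grading V_ ->
  exists v0 v1, [/\ v0 \in V_ false, v1 \in V_ true & v = v0 + v1].
Proof.
case=> _ Vfull; have : v \in (V_ false + V_ true)%VS by rewrite Vfull memvf.
by case/memv_addP=> v0 V0 [v1 V1 ->]; exists v0, v1.
Qed.

Lemma lmodule_torsion_free (K : fieldType) (V : lmodType K) (n : nat) (v : V) :
  [pchar K] =i pred0 -> v *+ n.+1 = 0 -> v = 0.
Proof.
move=> /pcharf0P charK0 /eqP; rewrite -scaler_nat scaler_eq0 charK0 /=.
by move/eqP.
Qed.

Section MockLie.

Variables (K : fieldType) (V : vectType K).
Variables (V_ : bool -> {vspace V}) (mul : {bilinear V -> V -> V}).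
Hypothesis mockLie : mock_Lie_superalgebra V_ mul.

Local Notation "x ** y" := (mul x y) (at level 40, left associativity).
Local Notation sgn i j := ((-1 : K) ^+ (i && j)).

(** No degree is imposed on [z], because the last argument [d] of the Jordan identity is
    arbitrary. *)
Lemma mock_Lie_mulM i j x y z : x \in V_ i -> y \in V_ j ->
  (x ** y) ** z = - (x ** (y ** z)) - sgn i j *: (y ** (x ** z)).
Proof.
case: mockLie => grad even comm jac Vx Vy.
have hom k w : w \in V_ k ->
    (x ** y) ** w = - (x ** (y ** w)) - sgn i j *: (y ** (x ** w)).
  move=> Vw; have := jac _ _ _ _ _ _ Vx Vy Vw.
  rewrite (comm _ _ _ _ (even _ _ _ _ Vx Vy) Vw) (comm _ _ _ _ Vw Vx).
  move/eqP; rewrite addrC addr_eq0 => /eqP E.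
  (* The sign for moving [x ** y] past [w] splits, as the product of degrees is biadditive. *)
  have -> : sgn (i (+) j) k = sgn i k * sgn j k.
    by rewrite -signr_addb; case: i j k {Vx Vy Vw E} => [] [] [].
  rewrite -scalerA E linearZ /= scalerN scalerDr !scalerA.
  rewrite -[sgn i k * sgn i k]expr2 sqrr_sign scale1r opprD.
  by rewrite [k && i]andbC mulrAC -expr2 sqrr_sign mul1r.
(* Both sides are additive in [z], so its even and odd components suffice. *)
have [z0 [z1 [Vz0 Vz1 ->]]] := Z2_gradingP z grad.
rewrite !linearDr (hom _ _ Vz0) (hom _ _ Vz1) scalerDr !opprD.
by rewrite addrACA.
Qed.

Lemma mock_Lie_super_Jordan : super_Jordan V_ mul.
Proof.
move=> i j k a b c d Va Vb Vc.
rewrite (mock_Lie_mulM (c ** d) Va Vb) (mock_Lie_mulM (a ** d) Vb Vc).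
rewrite (mock_Lie_mulM (b ** d) Vc Va) (mock_Lie_mulM d Va Vb).
rewrite (mock_Lie_mulM d Vb Vc) (mock_Lie_mulM d Vc Va).
rewrite !(linearBr, linearNr, linearZr_LR) /= !scalerBr !scalerN !scalerA.
rewrite [k && i]andbC [k && j]andbC.
rewrite [sgn j k * sgn i j]mulrC [sgn i j * sgn i k]mulrC.
rewrite [sgn i k * sgn j k]mulrC.
(* The left side pairs the six words by the letter acting first on [d], the right side by the
   outermost letter. *)
by rewrite [LHS](AC (2*2*2) ((1*6)*(3*2)*(5*4))).
Qed.

(** For odd [x], super-commutativity gives $2x^2=0$; for even [x], super-Jacobi gives $3x^3=0$.
    Characteristic $0$ allows division by 2 and 3. *)
Lemma mock_Lie_cube0 i x :
  [pchar K] =i pred0 -> x \in V_ i -> x ** (x ** x) = 0.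
Proof.
case: mockLie => _ _ comm jac charK0 Vx; case: i Vx => Vx.
  have /eqP := comm _ _ _ _ Vx Vx.
  rewrite /= scaleN1r -addr_eq0 -mulr2n => /eqP xx0.
  by rewrite (lmodule_torsion_free charK0 xx0) linear0.
have := jac _ _ _ _ _ _ Vx Vx Vx; rewrite /= !scale1r -mulr2n -mulrSr.
exact: lmodule_torsion_free.
Qed.

End MockLie.

Theorem proposition2p1 (K : fieldType) (charK0 : [pchar K] =i pred0)
    (J : vectType K) (J_ : bool -> {vspace J})
    (mul : {bilinear J -> J -> J}) :
  mock_Lie_superalgebra J_ mul ->
  Jordan_superalgebra J_ mul /\
  (forall (i : bool) (x : J), x \in J_ i -> mul x (mul x x) = 0).
Proof.
move=> mockLie; have [grad even comm _] := mockLie; split.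
  by split=> //; apply: mock_Lie_super_Jordan.
by move=> i x; apply: mock_Lie_cube0.
Qed.
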